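(* Let $n \ge 14$ be an even integer. Then $$T(n) \in \left\{\frac{3}{2}n +1,\ \frac{3}{2}n +2\right\}.$$
   Context: A (burnt) stack of $n$ pancakes is a sequence $[x_1,\dots,x_n]$, read from top to bottom, of nonzero integers such that $|x_1|,\dots,|x_n|$ is a permutation of $1,\dots,n$; a negative sign means that the burnt side of the pancake is face-up. For $1\le k\le n$, the flip $(k)$ transforms $[x_1,\dots,x_n]$ into $[-x_k,-x_{k-1},\dots,-x_1,x_{k+1},\dots,x_n]$. Let $I_n=[1,2,\dots,n]$ (the sorted stack) and $\overline{I_n}=[-1,-2,\dots,-n]$. $T(n)$ denotes the minimum number of flips required to transform $\overline{I_n}$ into $I_n$. *)

(* Defs.v *)
From mathcomp Require Import all_boot all_order all_algebra.

Set Implicit Arguments.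
Unset Strict Implicit.
Unset Printing Implicit Defensive.

Import GRing.Theory.

(* Stacks are lists read from top to bottom. *)
Definition is_stack (n : nat) (s : seq int) : bool :=
  perm_eq [seq absz x | x <- s] (iota 1 n).

Definition flip (k : nat) (s : seq int) : seq int :=
  [seq (- x)%R | x <- rev (take k s)] ++ drop k s.

Definition sorted_stack (n : nat) : seq int := [seq Posz i | i <- iota 1 n].

Definition neg_sorted_stack (n : nat) : seq int :=
  [seq (- Posz i)%R | i <- iota 1 n].

(* The flips of ks are performed from left to right. *)
Definition apply_flips (ks : seq nat) (s : seq int) : seq int :=
  foldl (fun t k => flip k t) s ks.

(* Some sequence of m flips takes s to t; i : 'I_n encodes the flip (i + 1). *)
Definition transforms_in (n : nat) (s t : seq int) (m : nat) : bool :=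
  [exists ks : m.-tuple 'I_n,
    apply_flips [seq (nat_of_ord i).+1 | i <- ks] s == t].

Lemma is_stack_sorted n : is_stack n (sorted_stack n).
Proof. by rewrite /is_stack /sorted_stack -map_comp map_id_in. Qed.

Lemma is_stack_neg_sorted n : is_stack n (neg_sorted_stack n).
Proof.
rewrite /is_stack /neg_sorted_stack -map_comp map_id_in // => i _ /=.
by rewrite abszN.
Qed.

Lemma is_stack_flip n k s : is_stack n s -> is_stack n (flip k s).
Proof.
rewrite /is_stack /flip; apply: perm_trans.
rewrite -[in X in perm_eq _ X](cat_take_drop k s) !map_cat perm_cat2r.
have -> : [seq absz x | x <- [seq (- x)%R | x <- rev (take k s)]]
          = rev [seq absz x | x <- take k s].
  by rewrite -map_comp -map_rev; apply: eq_map => x; apply: abszN.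
by rewrite perm_rev.
Qed.

(* Flipping k, then 1, then k turns over the k-th pancake only. *)
Lemma flip_single (s t : seq int) (x : int) :
  flip (size s).+1 (flip 1 (flip (size s).+1 (s ++ x :: t)))
  = s ++ (- x)%R :: t.
Proof.
have takeE (u v : seq int) y : take (size u).+1 (u ++ y :: v) = rcons u y.
  by rewrite -cat_rcons take_size_cat ?size_rcons.
have dropE (u v : seq int) y : drop (size u).+1 (u ++ y :: v) = v.
  by rewrite -cat_rcons drop_size_cat ?size_rcons.
rewrite /flip takeE dropE rev_rcons /= take0 drop0 /= opprK.
set w := [seq _ | _ <- rev s].
have -> : size s = size w by rewrite size_map size_rev.
rewrite take_size_cat // drop_size_cat // rev_cons map_rcons cat_rcons.
rewrite /w -map_rev revK -map_comp (eq_map (g := id)) ?map_id //.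
by move=> y /=; rewrite opprK.
Qed.

Lemma transforms_inI n ks s t :
  all (fun k => 1 <= k <= n) ks -> apply_flips ks s = t ->
  transforms_in n s t (size ks).
Proof.
move=> ks_ok st.
suff [ls [sz_ls ls_ks]] : exists ls : seq 'I_n,
    size ls = size ks /\ [seq (nat_of_ord i).+1 | i <- ls] = ks.
  apply/existsP; exists (tcast sz_ls (in_tuple ls)).
  by rewrite val_tcast /= ls_ks st.
elim: ks {st} ks_ok => [|k ks IHks] /=; first by exists [::].
case/andP=> /andP[k_gt0 le_kn] /IHks[ls [<- <-]].
have lt_kn : k.-1 < n by rewrite prednK.
by exists (Ordinal lt_kn :: ls); rewrite /= prednK.
Qed.

Lemma neg_sorted_sortable n :
  exists m, transforms_in n (neg_sorted_stack n) (sorted_stack n) m.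
Proof.
suff H k : k <= n -> exists2 ks, all (fun k => 1 <= k <= n) ks &
    apply_flips ks (neg_sorted_stack n)
    = sorted_stack k ++ [seq (- Posz i)%R | i <- iota k.+1 (n - k)].
  have [ks ks_ok ksE] := H n (leqnn n); exists (size ks).
  by apply: transforms_inI => //; rewrite ksE subnn cats0.
elim: k => [|k IHk] lt_kn; first by exists [::]; rewrite // subn0.
have [ks ks_ok ksE] := IHk (ltnW lt_kn).
exists (ks ++ [:: k.+1; 1; k.+1]).
  by rewrite all_cat ks_ok /= lt_kn (leq_ltn_trans (leq0n k) lt_kn).
have -> : sorted_stack k.+1 = sorted_stack k ++ [:: Posz k.+1].
  by rewrite /sorted_stack -[in LHS](addn1 k) iotaD map_cat add1n.
rewrite /apply_flips foldl_cat -/(apply_flips ks _) ksE subnS.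
have -> : n - k = (n - k).-1.+1 by rewrite prednK // subn_gt0.
have := @flip_single (sorted_stack k).
rewrite size_map size_iota /= => ->; rewrite opprK.
by rewrite -catA.
Qed.

Definition T (n : nat) : nat := ex_minn (neg_sorted_sortable n).

(* Main.v *)
Require Import Defs.
From mathcomp Require Import all_boot all_order all_algebra.
From mathcomp Require Import zify ring.

Set Implicit Arguments.
Unset Strict Implicit.
Unset Printing Implicit Defensive.

Import GRing.Theory.

(**
For even [n] a potential argument gives the lower of the two values as a lower
bound, and explicit sortings give the higher one as an upper bound.

Lower bound. A flip replaces a single pair of neighbours, so it creates at
most one adjacency [(x, x + 1)], and [n] adjacencies are needed, the one with
the floor included. To gain a factor 3/2 one also has to charge for the order
of the upside-down stack [-1, ..., -n]: count the descending triples
[(x, x - 1, x - 2)], of which that stack has [n] once it is continued below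
the floor, and record whether the partner of the top pancake is available, that
is, the right way up. Twice the number of adjacencies, minus the number of
triples, plus one if the partner is available, grows by at most 2 in a flip
(flip_potential): a flip that makes an adjacency needs the partner to be
available and destroys at most one triple, and if it destroys one, then no
partner is available afterwards; a flip that destroys two triples makes no
adjacency and leaves no partner available. The total growth from the
upside-down stack to the sorted one is [3 n + 1], hence [3 n < 2 T n]
(T_lower_bound).

Upper bound. In a sorting that nearly attains the lower bound, about half of
the junctions of the upside-down stack are cut without any gain, the others
are cut by flips that form an adjacency, and about [n / 2] further flips join
the resulting pieces. There is a family of such sortings for each class of
even [n] modulo 4. In both families a bounded number of pancakes is moved by a
fixed sequence of cuts, and the other pancakes by loops of three kinds:

- a run is unwound into a spiral, each flip leaving the next four pancakes
  behind; since the run is turned every time, these pancakes come alternately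
  from its two ends (uncoil), and the same flips in the opposite order wind the
  sorted pieces up into one run;
- in the unwound spiral every other pair of neighbours is brought to the top,
  with two flips for each pair (lift_pairs and lift_pairs_turn);
- pairs from the top are put between the pancakes of another list, again with
  two flips for each pair (drop_pairs).

The first pancakes of the successive coils obey a recurrence of the form
[t (m + 1) = f m - t m] (coil_run), and every comparison of two stacks reduces
to that recurrence.

For [n = 4 k + 16] the sorting is symmetric: there is a sequence [u] such that
flipping the whole stack, [u], flipping the whole stack, and [u] backwards
sort the upside-down stack. After its first flip that stack is
[n, ..., 1], so it is enough that [u] takes [n, ..., 1] and [1, ..., n] to
stacks that are each other's turn. Both are runs, so that one computation of
the effect of [u] serves for both (reach_half_way, half_way_sym). For
[n = 4 k + 22] the sorting is followed from beginning to end (reach_2mod4).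
The sizes 14 and 18 are settled by explicit lists of flips.
*)

Implicit Types (s u v w : seq int) (x y a b c d : int).

(** * Turning a pile over *)

Definition turn s : seq int := [seq (- x)%R | x <- rev s].

Lemma turn_cat s u : turn (s ++ u) = turn u ++ turn s.
Proof. by rewrite /turn rev_cat map_cat. Qed.

Lemma turn_cons x s : turn (x :: s) = rcons (turn s) (- x)%R.
Proof. by rewrite /turn rev_cons map_rcons. Qed.

Lemma size_turn s : size (turn s) = size s.
Proof. by rewrite size_map size_rev. Qed.

Lemma mem_turn x s : ((- x)%R \in turn s) = (x \in s).
Proof. by rewrite (mem_map oppr_inj) mem_rev. Qed.

Lemma turnK : involutive turn.
Proof.
move=> s; rewrite /turn -map_rev revK -map_comp map_id_in // => x _ /=.
exact: opprK.
Qed.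

Lemma flipE k s : flip k s = turn (take k s) ++ drop k s.
Proof. by []. Qed.

(** * The potential *)

Fixpoint adjacencies s : nat :=
  if s is x :: s' then
    (if s' is y :: _ then (y == x + 1)%R : nat else 0) + adjacencies s'
  else 0.

Definition triple a b c : bool := ((b == a - 1) && (c == b - 1))%R.

Fixpoint triples s : nat :=
  if s is x :: s' then
    (if s' is y :: z :: _ then triple x y z : nat else 0) + triples s'
  else 0.

Lemma adjacencies_join u x y v :
  adjacencies (rcons u x ++ y :: v)
  = adjacencies (rcons u x) + (y == x + 1)%R + adjacencies (y :: v).
Proof.
elim: u => [|z u IHu]; first by rewrite /= addn0.
case: u IHu => [|z' u] IHu; first by rewrite /= !addn0 addnA.
have -> : adjacencies (rcons [:: z, z' & u] x ++ y :: v)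
  = (z' == z + 1)%R + adjacencies (rcons (z' :: u) x ++ y :: v) by [].
by rewrite IHu !addnA.
Qed.

Lemma triples_join u x y z v :
  triples (rcons u x ++ [:: y, z & v])
  = triples (rcons u x)
    + (if u is w :: u' then triple (last w u') x y : nat else 0)
    + triple x y z + triples [:: y, z & v].
Proof.
elim: u => [|w u IHu] //.
case: u IHu => [|w' u] IHu; first by rewrite /=; lia.
have E t : triples (rcons [:: w, w' & u] x ++ t)
  = (if rcons u x is z' :: _ then triple w w' z' : nat else 0)
    + triples (rcons (w' :: u) x ++ t) by case: u {IHu}.
by rewrite -[X in _ = triples X + _ + _ + _]cats0 !E cats0 IHu /= !addnA.
Qed.

Lemma leq_triples_cat u v : triples u + triples v <= triples (u ++ v).
Proof.
elim: u => //= x u IHu; rewrite -addnA leq_add //.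
by case: u {IHu} => [|y [|z u]].
Qed.

Lemma adjacencies_turn s : adjacencies (turn s) = adjacencies s.
Proof.
elim: s => // x [|y s] // IHs.
have -> : adjacencies [:: x, y & s] = (y == x + 1)%R + adjacencies (y :: s).
  by [].
rewrite -IHs !turn_cons -[X in adjacencies X]cats1 adjacencies_join /= addn0.
have -> : ((- x)%R == (- y + 1)%R) = (y == (x + 1)%R) by lia.
lia.
Qed.

Lemma triples_turn s : triples (turn s) = triples s.
Proof.
elim: s => // x [|y [|z s]] // IHs.
have -> : triples [:: x, y, z & s] = triple x y z + triples [:: y, z & s].
  by [].
rewrite -IHs !turn_cons; move: (turn s) => u; clear.
suff E a : triples (rcons (rcons (rcons u (- z)) (- y)) a)%R
  = triple (- z) (- y) a + triples (rcons (rcons u (- z)) (- y))%R.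
  by rewrite E; congr (nat_of_bool _ + _); rewrite /triple; lia.
elim: u => [|x' u IHu] /=; first by rewrite !addn0.
rewrite IHu addnCA; congr (_ + (_ + _)).
by case: u {IHu} => [|y' [|z' u]].
Qed.

(** A flip makes an adjacency only by putting the top pancake [x], turned,
on [1 - x]. What is tested is that this partner is not in the stack the other
way up, as [x - 1]; thus a partner that is the floor, or that does not exist
because [x = 1], counts as available. *)
Definition available s : bool := (head 0 s - 1)%R \notin s.

(** The floor has two faces: it is the next pancake of the sorted stack
here, and the next two pancakes of the upside-down stack in [floor_triples].
Both stacks are then completely ordered down to the floor. *)
Definition floor_adjacencies n s := adjacencies (rcons s (Posz n.+1)).

Definition floor_triples n s :=
  triples (s ++ [:: - Posz n.+1; - Posz n.+2])%R.

Lemma stack_bound n s x : is_stack n s -> x \in s -> 0 < absz x <= n.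
Proof.
move=> /perm_mem E xs; have := E (absz x).
by rewrite map_f // mem_iota add1n ltnS => /esym.
Qed.

Lemma stack_size n s : is_stack n s -> size s = n.
Proof. by move/perm_size; rewrite size_map size_iota. Qed.

Lemma stack_uniq n s : is_stack n s -> uniq [seq absz x | x <- s].
Proof. by move/perm_uniq->; apply: iota_uniq. Qed.

Lemma stack_abs_inj n s : is_stack n s -> {in s &, injective absz}.
Proof.
move=> /stack_uniq s_uniq x y xs ys.
rewrite -(nth_index 0%R xs) -(nth_index 0%R ys).
move: xs ys; rewrite -!index_mem => xs ys xy; congr nth; apply/eqP.
by rewrite -(nth_uniq 0 _ _ s_uniq) ?size_map // !(nth_map 0%R) // xy.
Qed.

Lemma stack_opp n s x : is_stack n s -> x \in s -> (- x)%R \notin s.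
Proof.
move=> st_s xs; apply/negP => nxs.
have := stack_abs_inj st_s nxs xs (abszN x).
have := stack_bound st_s xs; clear; lia.
Qed.

Lemma adjacency_available n x u v : is_stack n (x :: u ++ v) ->
  head 0%R (rcons v (Posz n.+1)) = (- x + 1)%R -> available (x :: u ++ v).
Proof.
move=> st_s; rewrite /available [head _ (x :: _)]/=.
have -> : (x - 1 = - (- x + 1))%R by clear; ring.
case: v st_s => [|y v] st_s /= <-.
  by apply/negP => /(stack_bound st_s); clear; lia.
by apply: (stack_opp st_s); rewrite inE mem_cat mem_head !orbT.
Qed.

(** The top pancake [x] lands on [1 - x]. If this is the pancake [c] below the
cut, then a triple [(y, c, d)] has [d = - x], which is neither in the stack,
where the pancake [x] occurs only once, nor the floor. If it is the floor, then
[x = - n], and [c = - (n + 1)] forces [y = x]. *)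
Lemma adjacency_spares_triple n u v x y c d :
    1 < n -> is_stack n (rcons u y ++ v) ->
    head 0%R (rcons u y) = x ->
    head 0%R (rcons v (Posz n.+1)) = (- x + 1)%R ->
    (exists w, v ++ [:: - Posz n.+1; - Posz n.+2] = [:: c, d & w])%R ->
  ~~ triple y c d.
Proof.
move=> n_gt1 st_s ux vx [w vE]; apply/negP => /andP[/eqP cE /eqP dE].
have xs : x \in rcons u y ++ v.
  by rewrite mem_cat -ux -nth0 mem_nth ?size_rcons.
have x_bd := stack_bound st_s xs.
case: v => [|z [|z' v]] in vE vx st_s xs *;
  case: vE => cv dv _; rewrite /= in vx.
- case: u => [|x' u] in ux st_s xs *.
    by move: n_gt1; rewrite -(stack_size st_s).
  have := map_uniq (stack_uniq st_s); move: ux => /= ->.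
  rewrite cats0 /= mem_rcons inE (_ : x == y) //; apply/eqP.
  clear - cE vx cv; lia.
- clear - x_bd dE vx cv dv; lia.
have: z' \in rcons u y ++ [:: z, z' & v] by rewrite mem_cat !inE eqxx !orbT.
move/(stack_abs_inj st_s)/(_ xs); clear - x_bd dE vx cv dv; lia.
Qed.

(** Only the junction between the flipped part [u] and the rest [v] changes,
so at most one adjacency appears and at most two triples disappear: [split1]
ends with the first pancake below the cut and [split2] begins with the last
one above it. The gain 2 of a new adjacency is compensated because the
partner must have been available, and because [split2] is then impossible;
whenever [split1] occurs the partner is unavailable afterwards. *)
Lemma flip_potential n k s : 1 < n -> 0 < k <= n -> is_stack n s ->
  2 * floor_adjacencies n (flip k s) + available (flip k s) + floor_triples n s
  <= 2 * floor_adjacencies n s + available s + floor_triples n (flip k s) + 2.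
Proof.
move=> n_gt1 /andP[k_gt0 le_kn] st_s; rewrite flipE.
have: size (take k s) = k by rewrite size_takel // (stack_size st_s).
move: (cat_take_drop k s); move: (take k s) (drop k s) => u v sE sz_u.
have [x [u1 uE1]] : exists x u1, u = x :: u1.
  by case: u {sE} sz_u => [|x u1] sz_u; [rewrite -sz_u in k_gt0|exists x, u1].
have [y [u2 uE2]] : exists y u2, u = rcons u2 y.
  by case/lastP: u {sE uE1} sz_u => [|u2 y] sz_u;
    [rewrite -sz_u in k_gt0|exists y, u2].
have [z [va vaE]] : exists z w, rcons v (Posz n.+1) = z :: w.
  by case: (v) => [|z w];
    [exists (Posz n.+1), [::] | exists z, (rcons w (Posz n.+1))].
have [c [d [vd vdE]]] : exists c d w,
    (v ++ [:: - Posz n.+1; - Posz n.+2])%R = [:: c, d & w].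
  by case: (v) => [|z1 [|z2 w]] /=; do 3!eexists.
pose joined := (z == - x + 1)%R.
pose split1 := if u2 is w :: u3 then triple (last w u3) y c else false.
pose split2 := triple y c d.
have Anew : floor_adjacencies n (turn u ++ v)
    = adjacencies u + joined + adjacencies (rcons v (Posz n.+1)).
  rewrite /floor_adjacencies rcons_cat vaE {1}uE1 turn_cons adjacencies_join.
  by rewrite -turn_cons -uE1 adjacencies_turn.
have Aold : adjacencies u + adjacencies (rcons v (Posz n.+1))
    <= floor_adjacencies n s.
  rewrite /floor_adjacencies -sE rcons_cat vaE {1 2}uE2 adjacencies_join.
  by rewrite leq_add2r leq_addr.
have Dold : floor_triples n s = triples u + split1 + split2
    + triples (v ++ [:: - Posz n.+1; - Posz n.+2])%R.
  rewrite /floor_triples -sE -catA vdE {1}uE2 triples_join -uE2.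
  by rewrite /split1; case: (u2).
have Dnew : triples u + triples (v ++ [:: - Posz n.+1; - Posz n.+2])%R
    <= floor_triples n (turn u ++ v).
  by rewrite /floor_triples -catA -(triples_turn u) leq_triples_cat.
(* A triple cut after its second pancake leaves, upside down on top, that
   pancake and its would-be partner. *)
have Tnew : split1 -> available (turn u ++ v) = false.
  rewrite /split1 /available; case: (u2) uE2 => // w u3 uE /andP[/eqP yE _].
  have -> : head 0%R (turn u ++ v) = (- y)%R by rewrite uE /turn rev_rcons.
  have -> : (- y - 1)%R = (- last w u3)%R by rewrite yE; clear; ring.
  by rewrite mem_cat mem_turn uE mem_rcons inE mem_last orbT.
have Told : joined -> available s.
  move=> /eqP zE; rewrite -sE uE1; apply: (@adjacency_available n).
    by rewrite -cat_cons -uE1 sE.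
  by rewrite vaE.
have Tjoin : joined -> split2 = false.
  move=> /eqP zE; apply/negbTE.
  apply: (@adjacency_spares_triple n u2 v x) => //; first by rewrite -uE2 sE.
  - by rewrite -uE2 uE1.
  - by rewrite vaE.
  - by exists vd.
rewrite Anew Dold; move: Told Tjoin Tnew Aold Dnew; clear.
case: joined => [/(_ isT) -> /(_ isT) -> | _ _];
  case: split1 => [/(_ isT) -> | _]; lia.
Qed.

(** * The lower bound *)

Lemma floor_adjacencies_neg n : 0 < n ->
  floor_adjacencies n (neg_sorted_stack n) = 0.
Proof.
rewrite /floor_adjacencies /neg_sorted_stack => n_gt0; move: {1}n 1 => l.
elim: l => [|l IHl] m //=; rewrite IHl.
by case: l {IHl} => [|l] /=; lia.
Qed.

Lemma floor_triples_neg n : floor_triples n (neg_sorted_stack n) = n.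
Proof.
have -> : floor_triples n (neg_sorted_stack n)
    = triples [seq (- Posz i)%R | i <- iota 1 n.+2].
  have -> : iota 1 n.+2 = iota 1 n ++ [:: n.+1; n.+2].
    by rewrite -[in LHS]addn2 iotaD add1n.
  by rewrite map_cat.
move: n 1 => l; elim: l => // l IHl m.
have -> : [seq (- Posz i)%R | i <- iota m l.+3]
  = (- Posz m)%R :: [seq (- Posz i)%R | i <- iota m.+1 l.+2] by [].
rewrite -[in RHS](IHl m.+1) /= /triple; lia.
Qed.

Lemma floor_adjacencies_sorted n : floor_adjacencies n (sorted_stack n) = n.
Proof.
have -> : floor_adjacencies n (sorted_stack n)
    = adjacencies [seq Posz i | i <- iota 1 n.+1].
  have -> : iota 1 n.+1 = iota 1 n ++ [:: n.+1].
    by rewrite -[n.+1]addn1 iotaD add1n addn1.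
  by rewrite map_cat cats1.
move: n 1 => l; elim: l => // l IHl m.
rewrite -[in RHS](IHl m.+1) /=; lia.
Qed.

Lemma floor_triples_sorted n : floor_triples n (sorted_stack n) = 0.
Proof.
suff H : forall l m, 0 < m ->
    triples ([seq Posz i | i <- iota m l]
              ++ [:: - Posz n.+1; - Posz n.+2])%R = 0 by apply: H.
elim=> [|l IHl] m m_gt0 //=; rewrite IHl //.
by case: l {IHl} => [|[|l]] /=; rewrite /triple; lia.
Qed.

Lemma flips_potential n ks s : 1 < n -> is_stack n s ->
    all (fun k => 0 < k <= n) ks ->
  2 * floor_adjacencies n (apply_flips ks s) + available (apply_flips ks s)
    + floor_triples n s
  <= 2 * floor_adjacencies n s + available s
     + floor_triples n (apply_flips ks s) + 2 * size ks.
Proof.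
move=> n_gt1; elim: ks s => [|k ks IHks] s st_s /=.
  by rewrite muln0 addn0.
case/andP=> k_ok ks_ok.
have := IHks _ (is_stack_flip k st_s) ks_ok.
have := flip_potential n_gt1 k_ok st_s; lia.
Qed.

Lemma T_lower_bound n : 1 < n -> 3 * n < 2 * T n.
Proof.
move=> n_gt1; rewrite /T; case: ex_minnP => m /existsP[ks /eqP ksE] _.
have ks_ok : all (fun k => 0 < k <= n) [seq (nat_of_ord i).+1 | i <- ks].
  by apply/allP => _ /mapP[i _ ->]; apply: ltn_ord.
have := flips_potential n_gt1 (is_stack_neg_sorted n) ks_ok.
rewrite ksE floor_adjacencies_sorted floor_triples_sorted floor_triples_neg.
rewrite floor_adjacencies_neg ?(ltnW n_gt1) // size_map size_tuple.
have -> : available (neg_sorted_stack n) = false.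
  by move: n_gt1; rewrite /available; case: (n) => [|[|]].
have -> : available (sorted_stack n) = true.
  rewrite /available; move: n_gt1; case: (n) => // l _.
  by apply/negP => /mapP[i]; rewrite mem_iota /=; lia.
lia.
Qed.

(** * Reachability *)

(** The bound [size ks <= m] rather than an equality makes the flip of an
empty pile available, at no cost: in [reach_flip] the pile [u] may be
empty. *)
Definition reach (m : nat) s t : Prop :=
  exists ks, [/\ size ks <= m, all (fun k => 0 < k <= size s) ks
               & apply_flips ks s = t].

Lemma size_flip k s : size (flip k s) = size s.
Proof. by rewrite flipE size_cat size_turn -size_cat cat_take_drop. Qed.

Lemma size_reach m s t : reach m s t -> size t = size s.
Proof.
case=> ks [_ _ <-]; elim: ks s => //= k ks IHks s.
by rewrite IHks size_flip.
Qed.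

Lemma reach_refl s : reach 0 s s.
Proof. by exists [::]. Qed.

Lemma reach_trans m1 m2 s t u : reach m1 s t -> reach m2 t u ->
  reach (m1 + m2) s u.
Proof.
move=> R1; have szt := size_reach R1; case: R1 => ks1 [sz1 ok1 E1].
case=> ks2 [sz2 ok2 E2]; exists (ks1 ++ ks2); split.
- by rewrite size_cat leq_add.
- by rewrite all_cat ok1 -szt.
- by rewrite /apply_flips foldl_cat -/(apply_flips ks1 s) E1.
Qed.

Lemma reach_flip u v : reach 1 (u ++ v) (turn u ++ v).
Proof.
case: (posnP (size u)) => [/size0nil -> | u_gt0]; first by exists [::].
exists [:: size u]; split=> //=; first by rewrite u_gt0 size_cat leq_addr.
by rewrite flipE take_size_cat // drop_size_cat.
Qed.

(** A flip is an involution. *)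
Lemma reach_sym m s t : reach m s t -> reach m t s.
Proof.
case=> ks [sz_ks ks_ok <-]; exists (rev ks); split.
- by rewrite size_rev.
- rewrite all_rev; suff -> : size (apply_flips ks s) = size s by [].
  by elim: ks s {sz_ks ks_ok} => //= k ks IHks s; rewrite IHks size_flip.
elim: ks s {sz_ks} ks_ok => //= k ks IHks s /andP[/andP[_ le_ks] ks_ok].
rewrite rev_cons -cats1 /apply_flips foldl_cat -/(apply_flips _ _) /=.
rewrite -/(apply_flips ks (flip k s)).
have := IHks (flip k s); rewrite size_flip => /(_ ks_ok); rewrite /apply_flips.
move=> ->; rewrite flipE.
rewrite {1}/flip take_size_cat ?drop_size_cat ?size_turn ?size_takel //.
by rewrite -/(turn _) turnK cat_take_drop.
Qed.

Lemma T_leq n m : reach m (neg_sorted_stack n) (sorted_stack n) -> T n <= m.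
Proof.
case=> ks [sz_ks ks_ok ksE]; apply: leq_trans sz_ks.
rewrite /T; case: ex_minnP => j _; apply.
apply: transforms_inI ksE.
by move: ks_ok; rewrite size_map size_iota.
Qed.

(** A stack cut into piles that are only moved and turned as a whole is
described by the list of the indices of the piles, from top to bottom, each
with a boolean that tells whether the pile is turned. A flip is then given by
the number of piles that it takes, whatever their sizes, and a sequence of
flips is carried out by computation on these descriptions. *)
Definition stack_of (piles : seq (seq int)) (st : seq (bool * nat)) : seq int :=
  flatten [seq if p.1 then turn (nth [::] piles p.2) else nth [::] piles p.2
          | p <- st].

Definition cut (st : seq (bool * nat)) i : seq (bool * nat) :=
  [seq (~~ p.1, p.2) | p <- rev (take i st)] ++ drop i st.

Lemma reach_cut piles st i :
  reach 1 (stack_of piles st) (stack_of piles (cut st i)).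
Proof.
rewrite -{1}(cat_take_drop i st) /cut /stack_of !map_cat !flatten_cat.
set u := flatten _; set v := flatten _.
suff -> : flatten [seq (if p.1 then turn (nth [::] piles p.2)
                        else nth [::] piles p.2)
   | p <- [seq (~~ p.1, p.2) | p <- rev (take i st)]] = turn u.
  exact: reach_flip.
rewrite /u; elim: (take i st) => //= -[b j] w IHw.
rewrite turn_cat -IHw rev_cons !map_rcons -cats1 flatten_cat /= cats0.
by case: b => /=; rewrite ?turnK.
Qed.

Lemma reach_cuts piles cuts :
  reach (size cuts) (flatten piles)
    (stack_of piles
       (foldl cut [seq (false, i) | i <- iota 0 (size piles)] cuts)).
Proof.
set st := [seq _ | _ <- _].
have -> : flatten piles = stack_of piles st.
  by rewrite /stack_of /st -map_comp map_nth_iota0 // take_size.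
elim: cuts st => [|i cuts IH] st; first exact: reach_refl.
by rewrite /= -add1n; apply: reach_trans (IH _); apply: reach_cut.
Qed.

(** * Spirals *)

Section Spirals.
Variables p q : nat -> seq int.

Fixpoint spiral m : seq int :=
  if m is m'.+1 then spiral m' ++ p m' ++ q m' else [::].

Fixpoint coil u m : seq int :=
  if m is m'.+1 then turn (coil u m' ++ p m') ++ q m' else u.

(** The outermost piece is [q] of the last index: flipping all that lies above
it turns the inner coil back and leaves [p] of that index on [q]. *)
Lemma uncoil u v k : reach k (coil u k ++ v) (u ++ spiral k ++ v).
Proof.
elim: k v => [|k IHk] v; first exact: reach_refl.
rewrite -add1n.
have := reach_flip (turn (coil u k ++ p k)) (q k ++ v).
rewrite turnK /= -!catA => /reach_trans; apply.
exact: IHk.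
Qed.

End Spirals.

(** * Moving pairs to the top and back *)

Section Lifts.
Variables a b c d : nat -> int.

Let dom := spiral (fun m => [:: d m]) (fun m => [:: a m; b m; c m]).

Fixpoint lifted m : seq int :=
  if m is m'.+1 then lifted m' ++ [:: - a m'; - d m']%R else [::].

Fixpoint kept m : seq int :=
  if m is m'.+1 then kept m' ++ [:: b m'; c m'] else [::].

Lemma lift_pair x y z u v :
  reach 2 (x :: u ++ [:: y, z & v]) [:: - z, - y, x & u ++ v]%R.
Proof.
have R1 := reach_flip (x :: u) [:: y, z & v].
have R2 := reach_flip (turn (x :: u) ++ [:: y; z]) v.
by move: R2; rewrite turn_cat turnK -catA => /(reach_trans R1).
Qed.

(** The outermost pair is lifted first, so that the lifted pairs end up in the
order of the spiral. *)
Lemma lift_pairs x u v k :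
  reach (2 * k) (x :: u ++ dom k ++ v) (lifted k ++ x :: u ++ kept k ++ v).
Proof.
elim: k x u v => [|k IHk] x u v; first exact: reach_refl.
rewrite mulnS.
have := lift_pair x (d k) (a k) (u ++ dom k) [:: b k, c k & v].
rewrite -!catA => /reach_trans; apply.
exact: IHk (- a k)%R [:: - d k, x & u]%R [:: b k, c k & v].
Qed.

(** In a turned spiral the innermost pair is the lowest one and is lifted
first. *)
Lemma lift_pairs_turn x u v k :
  reach (2 * k) (x :: u ++ turn (dom k) ++ v)
                (turn (lifted k) ++ x :: u ++ turn (kept k) ++ v).
Proof.
elim: k u => [|k IHk] u; first exact: reach_refl.
rewrite mulnS addnC /= !turn_cat /=.
have := IHk (u ++ turn [:: d k; a k; b k; c k]).
rewrite -!catA => /reach_trans; apply.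
have [y [w wE]] : exists y w, turn (lifted k) ++ [:: x] = y :: w.
  by case: (turn _) => [|y w]; [exists x, [::] | exists y, (w ++ [:: x])].
have := lift_pair y (- a k)%R (- d k)%R (w ++ u ++ [:: - c k; - b k]%R)
  (turn (kept k) ++ v).
have E t : turn (lifted k) ++ x :: t = y :: w ++ t by rewrite -cat1s catA wE.
by rewrite !E -!catA.
Qed.
End Lifts.

Lemma drop_pair x y u v : reach 2 [:: x, y & u ++ v] (u ++ [:: - y, - x & v]%R).
Proof.
have R1 := reach_flip [:: x, y & u] v.
have R2 := reach_flip (turn u) ([:: - y; - x]%R ++ v).
by move: R1; rewrite !turn_cons -!cats1 -!catA => /reach_trans;
  apply; rewrite turnK in R2.
Qed.

Section Drops.
(** The pairs [a, d] and [b, c] of the lifted and kept pancakes are used with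
a shift by one, [d] being [- z] and [c] being [y] at the next index: the pairs
that are dropped straddle those that were kept, and they are dropped in the
middle of those that were lifted. *)
Variables a b y z : nat -> int.

Let weave :=
  spiral (fun m => [:: z m; - a m; - b m]%R) (fun m => [:: - y m]%R).

Let lifted := lifted a (fun m => - z m.+1)%R.
Let kept := kept b (fun m => y m.+1).

Lemma drop_pairs u v k :
  reach (2 * k) (y 0 :: kept k ++ u ++ z 0 :: lifted k ++ v)
                (y k :: u ++ weave k ++ z k :: v).
Proof.
elim: k u v => [|k IHk] u v; first exact: reach_refl.
have := IHk ([:: b k; y k.+1] ++ u) ([:: - a k; z k.+1]%R ++ v).
rewrite /kept /lifted /= !opprK -!catA mulnS addnC => /reach_trans; apply.
have := drop_pair (y k) (b k) (y k.+1 :: u ++ weave k ++ [:: z k; - a k]%R)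
  (z k.+1 :: v).
by rewrite /= -!catA.
Qed.
End Drops.

(** * Runs and their coils *)

(** For [e = 1] and [e = -1] the runs are the ordered piles, ascending and
descending. *)
Definition run (e x : int) l : seq int :=
  [seq (x + e * Posz i)%R | i <- iota 0 l].

Lemma run_cat e x l1 l2 :
  run e x (l1 + l2) = run e x l1 ++ run e (x + e * Posz l1)%R l2.
Proof.
rewrite /run iotaD map_cat add0n; congr (_ ++ _).
rewrite -[in LHS](addn0 l1) iotaDl -map_comp; apply: eq_map => i /=.
by rewrite PoszD mulrDr addrA.
Qed.

Lemma turn_run e x l : turn (run e x l) = run e (e - x - e * Posz l)%R l.
Proof.
elim: l x => // l IHl x.
rewrite -add1n run_cat turn_cat IHl addnC run_cat; congr (_ ++ _).
  by congr run; rewrite !PoszD; ring.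
by rewrite /turn /run /= !PoszD; congr [:: _]; ring.
Qed.

Lemma reach_turn_run e x y l v : y = (e - x - e * Posz l)%R ->
  reach 1 (run e x l ++ v) (run e y l ++ v).
Proof. by move=> ->; rewrite -turn_run; apply: reach_flip. Qed.

(** A run of length [l'] that starts with [t] becomes, once turned, a run that
starts with [e - t - e * l'] and ends with [- t], so that [e - t] continues it.
Thus a run is a coil whose pieces are runs, and the first pancakes of the
successive coils satisfy a first-order recurrence. *)
Lemma coil_run e l i j t p q k :
  (forall m, t m.+1 = e - t m - e * Posz (l + (i + j) * m + i))%R ->
  (forall m, p m = run e (t m + e * Posz (l + (i + j) * m)) i)%R ->
  (forall m, q m = run e (e - t m)%R j) ->
  coil p q (run e (t 0) l) k = run e (t k) (l + (i + j) * k).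
Proof.
move=> tS pE qE; elim: k => [|k /= ->]; first by rewrite muln0 addn0.
rewrite pE qE -run_cat turn_run -tS.
have -> : l + (i + j) * k.+1 = l + (i + j) * k + i + j by ring.
rewrite [RHS]run_cat tS; congr (_ ++ run _ _ _); ring.
Qed.

(** In the applications the outermost coil, of index [k], is given, and the
recurrence is to be solved inwards. *)
Lemma recurrence_back (f : nat -> int) k x :
  exists t : nat -> int, t k = x /\ (forall m, t m.+1 = f m - t m)%R.
Proof.
elim: k x => [|k IHk] x.
  exists (fix t m := if m is m'.+1 then f m' - t m' else x)%R; split=> //.
have [t [tk tS]] := IHk (f k - x)%R.
by exists t; split=> //; rewrite tS tk; ring.
Qed.

(** * Sizes divisible by 4 *)

(** The letters [r] are the innermost coil, [w] is the spiral unwound around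
it, and [z] and [y] are the last nine pancakes. *)
Lemma half_opening (r z y : nat -> int) w :
  reach 9
    ([:: r 0; r 1; r 2; r 3; r 4; r 5; r 6] ++ w
     ++ [:: z 0; z 1; z 2; z 3; y 0; y 1; y 2; y 3; y 4])
    ([:: - y 0; - z 3; - z 2; y 2; y 1; - r 1; - r 0; r 5; r 6] ++ w
     ++ [:: y 4; y 3; - z 1; - z 0; - r 4; - r 3; - r 2])%R.
Proof.
exact: (reach_cuts ([seq [:: r i] | i <- iota 0 7] ++ w
  :: [seq [:: z i] | i <- iota 0 4] ++ [seq [:: y i] | i <- iota 0 5])
  [:: 5; 8; 16; 6; 4; 11; 17; 11; 4]).
Qed.

Lemma half_closing (r z y : nat -> int) u w :
  reach 2
    (u ++ [:: - y 0; - z 3; - z 2; y 2; y 1; - r 1; - r 0; r 5; r 6] ++ w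
     ++ [:: y 4; y 3; - z 1; - z 0; - r 4; - r 3; - r 2])%R
    ([:: r 3; r 4; z 0; z 1; - y 3; - y 4] ++ turn w ++ [:: - r 6; - r 5; r 0]
     ++ u ++ [:: - y 0; - z 3; - z 2; y 2; y 1; - r 1; - r 2])%R.
Proof.
have := reach_cuts [:: u; [:: - y 0; - z 3; - z 2; y 2; y 1]; [:: - r 1];
  [:: - r 0; r 5; r 6]; w; [:: y 4; y 3; - z 1; - z 0; - r 4; - r 3];
  [:: - r 2]]%R [:: 3; 6].
by rewrite /stack_of /= !opprK.
Qed.

Section Half.
Variables (e : int) (t : nat -> int).

Definition half_lifted := lifted (fun m => e - t m)%R (fun m => - t m.+1)%R.
Definition half_kept :=
  kept (fun m => e *+ 2 - t m)%R (fun m => e *+ 3 - t m)%R.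

(** Where the sequence [u] takes a run of sign [e]. After the first flip of [u]
the last nine pancakes are two runs, which start with [z] and [y]. *)
Definition half_way k (z y : int) : seq int :=
  let r i := (t 0 + e * Posz i)%R in
  let z i := (z + e * Posz i)%R in
  let y i := (y + e * Posz i)%R in
  ([:: r 3; r 4; z 0; z 1; - y 3; - y 4] ++ turn (half_kept k)
   ++ [:: - r 6; - r 5; r 0] ++ half_lifted k
   ++ [:: - y 0; - z 3; - z 2; y 2; y 1; - r 1; - r 2])%R.

Lemma reach_half_way_coil k z y :
    (forall m, t m.+1 = - e * Posz (7 + 4 * m) - t m)%R ->
  reach (11 + 3 * k)
    (run e (t k) (7 + 4 * k) ++ run e z 4 ++ run e y 5) (half_way k z y).
Proof.
move=> tS.
pose a m := (e - t m)%R; pose b m := (e *+ 2 - t m)%R.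
pose c m := (e *+ 3 - t m)%R; pose d m := (- t m.+1)%R.
have <- : coil (fun m => [:: d m]) (fun m => [:: a m; b m; c m])
    (run e (t 0) 7) k = run e (t k) (7 + 4 * k).
  apply: (@coil_run e 7 1 3) => m.
  - by rewrite tS !PoszD; ring.
  - by rewrite /d /run /= tS; congr [:: _]; ring.
  - by rewrite /a /b /c /run /=; congr [:: _; _; _]; ring.
rewrite (_ : 11 + 3 * k = k + (9 + (2 * k + 2))); last by ring.
apply: reach_trans (uncoil _ _ _ _ _) _.
pose r i := (t 0 + e * Posz i)%R.
pose z' i := (z + e * Posz i)%R; pose y' i := (y + e * Posz i)%R.
apply: reach_trans (half_opening r z' y' _) _.
exact: reach_trans (lift_pairs a b c d _ [:: - z' 3; - z' 2; y' 2; y' 1; - r 1;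
  - r 0; r 5; r 6]%R _ k) (half_closing r z' y' _ _).
Qed.

End Half.

Lemma neg_sorted_run n : neg_sorted_stack n = run (-1) (-1) n.
Proof.
rewrite /neg_sorted_stack /run -[1]addn0 iotaDl -map_comp.
by apply: eq_map => i /=; rewrite PoszD; ring.
Qed.

Lemma sorted_run n : sorted_stack n = run 1 1 n.
Proof.
rewrite /sorted_stack /run -[in iota 1 n](addn0 1) iotaDl -map_comp.
by apply: eq_map => i /=; rewrite PoszD; ring.
Qed.

(** The pairs lifted in one half are, with a shift by one, the pairs kept in
the other half. *)
Lemma half_match e t t' k : (forall m, t' m.+1 = e *+ 2 - t m)%R ->
  half_lifted (- e) t' k ++ [:: t' k + e]%R = (t' 0 + e)%R :: half_kept e t k.
Proof.
move=> tS; elim: k => [|k IHk] //.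
rewrite /half_kept /= -cat_cons -/(half_kept e t k) -IHk -!catA; congr (_ ++ _).
rewrite /= tS; congr [:: _; _; _]; ring.
Qed.

(** The turn exchanges the lifted and the kept pairs, which [half_match]
identifies; the other pancakes are compared one by one. *)
Lemma half_way_sym k (t t' : nat -> int) :
  let l := Posz (4 * k) in
  t' 0 = (t 0 + 5)%R -> t k = (- l - 11)%R -> t' k = (- 6)%R ->
  (forall m, t' m.+1 = 2 - t m)%R -> (forall m, t m.+1 = - 2 - t' m)%R ->
  turn (half_way (-1) t' k (- l - 13) 5) = half_way 1 t k (- 4) (l + 12).
Proof.
move=> l t'0 tk t'k t'S tS.
have E1 := half_match k t'S.
have E2 := @half_match (-1) t' t k tS.
have cat_shift s x u : s ++ x :: u = (s ++ [:: x]) ++ u by rewrite -catA.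
rewrite /half_way (cat_shift (half_lifted (-1) t' k)).
rewrite (cat_shift (half_lifted 1 t k)).
have -> : (- (5 + -1 * 0) = t' k + 1)%R by rewrite t'k.
have -> : (- (l + 12 + 1 * 0) = t k - 1)%R by rewrite tk; ring.
rewrite E1 (E2 : half_lifted 1 t k ++ _ = _).
rewrite !turn_cat !turnK (turn_cons _ (half_kept 1 t k)) -cats1 -!catA.
congr (_ ++ (_ ++ _)).
  by rewrite /turn /= t'0; congr [:: _; _; _; _; _; _]; ring.
rewrite /turn /= t'0.
by congr [:: _, _, _, _ & _ ++ [:: _; _; _; _; _; _]]; ring.
Qed.

Lemma reach_half_way e t k x :
    (forall m, t m.+1 = - e * Posz (7 + 4 * m) - t m)%R ->
    t k = (e - x - e * Posz (11 + 4 * k))%R ->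
  reach (12 + 3 * k) (run e x (16 + 4 * k))
    (half_way e t k (t k + e * Posz (7 + 4 * k)) (x + e * Posz (11 + 4 * k))).
Proof.
move=> tS tk; rewrite (_ : 16 + 4 * k = 11 + 4 * k + 5); last by ring.
rewrite run_cat -[12]/(1 + 11) -addnA.
apply: reach_trans (reach_flip _ _) _; rewrite turn_run -tk.
rewrite {1}(_ : 11 + 4 * k = 7 + 4 * k + 4); last by ring.
by rewrite run_cat -catA; apply: reach_half_way_coil.
Qed.

Lemma reach_0mod4 k :
  reach (26 + 6 * k) (neg_sorted_stack (16 + 4 * k))
                     (sorted_stack (16 + 4 * k)).
Proof.
have [t [tk tS]] :=
  recurrence_back (fun m => - Posz (7 + 4 * m))%R k (- Posz (4 * k) - 11)%R.
(* The first pancakes of the coils in the descending half, [t'], are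
determined by [t' k = - 6]; the two recurrences make [t' - t] affine. *)
pose t' m := (t m + 5 + Posz (4 * m))%R.
have tS1 m : (t' m.+1 = 2 - t m)%R by rewrite /t' tS !PoszD; ring.
have tS2 m : (t m.+1 = - 2 - t' m)%R by rewrite /t' tS !PoszD; ring.
have t'k : t' k = (- 6)%R by rewrite /t' tk; ring.
set n := 16 + 4 * k; set l := Posz (4 * k).
have R0 : reach 1 (run (-1) (-1) n) (run (-1) (Posz n) n).
  have := @reach_turn_run (-1) (-1) (Posz n) n [::].
  by rewrite !cats0; apply; ring.
have R1 : reach (12 + 3 * k) (run (-1) (Posz n) n)
    (half_way (-1) t' k (- l - 13) 5).
  have := @reach_half_way (-1) t' k (Posz n); rewrite t'k -/n.
  rewrite (_ : - 6 + -1 * Posz (7 + 4 * k) = - l - 13)%R;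
    last by rewrite /l !PoszD; ring.
  rewrite (_ : Posz n + -1 * Posz (11 + 4 * k) = 5)%R;
    last by rewrite /n !PoszD; ring.
  apply=> [m|]; last by rewrite /n !PoszD; ring.
  by rewrite tS1 /t' PoszD; ring.
have R2 : reach (12 + 3 * k) (run 1 1 n) (half_way 1 t k (- 4) (l + 12)).
  have := @reach_half_way 1 t k 1; rewrite tk -/n.
  rewrite (_ : - Posz (4 * k) - 11 + 1 * Posz (7 + 4 * k) = - 4)%R;
    last by rewrite !PoszD; ring.
  rewrite (_ : 1 + 1 * Posz (11 + 4 * k) = l + 12)%R;
    last by rewrite /l !PoszD; ring.
  apply=> [m|]; last by rewrite !PoszD; ring.
  by rewrite tS; ring.
have R3 := reach_flip (half_way (-1) t' k (- l - 13) 5) [::].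
rewrite !cats0 (@half_way_sym k t t') // in R3; last by rewrite /t'; ring.
rewrite neg_sorted_run sorted_run.
rewrite (_ : 26 + 6 * k = 1 + ((12 + 3 * k) + (1 + (12 + 3 * k))));
  last by ring.
exact: reach_trans R0 (reach_trans R1 (reach_trans R3 (reach_sym R2))).
Qed.

(** * Sizes congruent to 2 modulo 4 *)

(** Here [r] is the innermost coil, [w] the spiral, and [z] and [y] the last
four and the first seven pancakes. *)
Lemma full_opening (r z y : nat -> int) w :
  reach 17
    ([:: r 0; r 1; r 2; r 3; r 4; r 5; r 6; r 7; r 8; r 9; r 10] ++ w
     ++ [:: z 0; z 1; z 2; z 3; y 0; y 1; y 2; y 3; y 4; y 5; y 6])
    ([:: - r 0; r 8; r 7; - r 3; - r 4; z 0; z 1; z 2; y 3; y 2; - y 5; - y 6]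
     ++ turn w
     ++ [:: - r 10; - r 9; r 2; r 1; y 4; r 6; r 5; - y 1; - y 0; - z 3])%R.
Proof.
exact: (reach_cuts ([seq [:: r i] | i <- iota 0 11] ++ w
  :: [seq [:: z i] | i <- iota 0 4] ++ [seq [:: y i] | i <- iota 0 7])
  [:: 8; 4; 12; 22; 3; 7; 23; 18; 7; 20; 14; 5; 8; 5; 19; 12; 16]).
Qed.

Lemma full_middle (r z y : nat -> int) u w :
  reach 5
    (turn u
     ++ [:: - r 0; r 8; r 7; - r 3; - r 4; z 0; z 1; z 2; y 3; y 2; - y 5;
            - y 6]
     ++ turn w
     ++ [:: - r 10; - r 9; r 2; r 1; y 4; r 6; r 5; - y 1; - y 0; - z 3])%R
    ([:: r 10] ++ w
     ++ [:: y 6; y 5; y 4; r 6; r 5; - y 1; - y 2; - y 3; - z 2; - z 1; - z 0;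
         r 4; r 3; - r 7; - r 8; - r 9; r 2; r 1; r 0]
     ++ u ++ [:: - y 0; - z 3])%R.
Proof.
have := reach_cuts (turn u
  :: [seq [:: x] | x <- [:: - r 0; r 8; r 7; - r 3; - r 4; z 0; z 1; z 2; y 3;
                           y 2; - y 5; - y 6]]
  ++ turn w
  :: [seq [:: x] | x <- [:: - r 10; - r 9; r 2; r 1; y 4; r 6; r 5; - y 1;
                           - y 0; - z 3]])%R [:: 22; 11; 7; 20; 17].
by rewrite /stack_of /= !opprK !turnK.
Qed.

Lemma full_closing (r z y : nat -> int) g x x' :
  reach 10
    ([:: x; y 6; y 5; y 4; r 6; r 5; - y 1; - y 2; - y 3; - z 2; - z 1; - z 0;
         r 4; r 3; - r 7; - r 8; - r 9; r 2; r 1]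
     ++ g ++ [:: x'; - y 0; - z 3])%R
    ([:: r 9; r 8; r 7; r 6; r 5; r 4; r 3; r 2; r 1] ++ g
     ++ [:: x'; - y 0; - y 1; - y 2; - y 3; - y 4; - y 5; - y 6]
     ++ [:: - x; - z 0; - z 1; - z 2; - z 3])%R.
Proof.
have := reach_cuts (
  [seq [:: i] | i <- [:: x; y 6; y 5; y 4; r 6; r 5; - y 1; - y 2; - y 3; - z 2;
      - z 1; - z 0; r 4; r 3; - r 7; - r 8; - r 9; r 2; r 1]]
  ++ g :: [seq [:: i] | i <- [:: x'; - y 0; - z 3]])%R
  [:: 11; 12; 11; 22; 18; 8; 21; 15; 4; 7].
by rewrite /stack_of /= !opprK.
Qed.

Lemma reach_2mod4 k :
  reach (35 + 6 * k) (neg_sorted_stack (22 + 4 * k))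
                     (sorted_stack (22 + 4 * k)).
Proof.
(* The coil of index [m] starts with [t m]; the piece around it consists of
[d m], on its inner side, and of [a m, b m, c m]. *)
have [t [tk tS]] := recurrence_back (fun m => Posz (11 + 4 * m))%R k (- 8)%R.
pose a m := (- 1 - t m)%R; pose b m := (- 2 - t m)%R.
pose y m := (t m - 10 - Posz (4 * m))%R.
pose c m := y m.+1; pose d m := (- t m.+1)%R.
pose r i := (t 0 + -1 * Posz i)%R.
pose z i := (- Posz (19 + 4 * k) + -1 * Posz i)%R.
pose y' i := (7 + -1 * Posz i)%R.
set n := 22 + 4 * k.
pose dom := spiral (fun m => [:: d m]) (fun m => [:: a m; b m; c m]).
pose g := spiral (fun m => [:: t m; - a m; - b m]%R) (fun m => [:: - y m]%R).
have R0 : reach 2 (run (-1) (-1) n)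
    (run (-1) (- 8) (11 + 4 * k) ++ run (-1) (- Posz (19 + 4 * k)) 4
     ++ run (-1) 7 7).
  have := @reach_turn_run (-1) (-1) (Posz n) n [::]; rewrite !cats0 => R.
  have nE : n = 11 + 4 * k + 4 + 7 by rewrite /n; ring.
  have zE : (- Posz (19 + 4 * k) = - 8 + -1 * Posz (11 + 4 * k))%R.
    by rewrite !PoszD; ring.
  have yE : (7 = Posz n + -1 * Posz (11 + 4 * k + 4))%R.
    by rewrite nE !PoszD; ring.
  apply: (@reach_trans 1 1) (R _) _; first by ring.
  rewrite catA zE -run_cat {2}nE run_cat -yE; apply: reach_turn_run.
  by rewrite nE !PoszD; ring.
have R1 := uncoil (fun m => [:: d m]) (fun m => [:: a m; b m; c m])
  (run (-1) (t 0) 11) (run (-1) (- Posz (19 + 4 * k)) 4 ++ run (-1) 7 7) k.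
rewrite (@coil_run (-1) 11 1 3 t) in R1; first last.
- by move=> m; rewrite /a /b /c /y /run /= tS !PoszD; congr [:: _; _; _]; ring.
- by move=> m; rewrite /d /run /= tS !PoszD; congr [:: _]; ring.
- by move=> m; rewrite tS !PoszD; ring.
have R2 := full_opening r z y' (dom k).
have R3 := lift_pairs_turn a b c d (- r 0)%R [:: r 8; r 7; - r 3; - r 4; z 0;
  z 1; z 2; y' 3; y' 2; - y' 5; - y' 6]%R [:: - r 10; - r 9; r 2; r 1; y' 4;
  r 6; r 5; - y' 1; - y' 0; - z 3]%R k.
have R4 := full_middle r z y' (lifted a d k) (kept b c k).
have R5 := drop_pairs a b y t [:: y' 6; y' 5; y' 4; r 6; r 5; - y' 1; - y' 2;
  - y' 3; - z 2; - z 1; - z 0; r 4; r 3; - r 7; - r 8; - r 9; r 2; r 1]%R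
  [:: - y' 0; - z 3]%R k.
have R6 := full_closing r z y' (g k) (y k) (t k).
(* The sorted pieces are wound up in coils that start with [s m]. *)
pose s m := (t m - 9 - Posz (4 * m))%R.
have R7 := reach_sym (uncoil (fun m => [:: t m; - a m; - b m]%R)
  (fun m => [:: - y m]%R) (run 1 (s 0) 9)
  ([:: t k; - y' 0; - y' 1; - y' 2; - y' 3; - y' 4; - y' 5; - y' 6]
   ++ [:: - y k; - z 0; - z 1; - z 2; - z 3])%R k).
rewrite (@coil_run 1 9 3 1 s) in R7; first last.
- by move=> m; rewrite /y /s /run /=; congr [:: _]; ring.
- by move=> m; rewrite /a /b /s /run /= !PoszD; congr [:: _; _; _]; ring.
- by move=> m; rewrite /s tS !PoszD; ring.
have R8 := reach_flip (run 1 (s k) (9 + 4 * k) ++ [:: t k; - y' 0; - y' 1;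
  - y' 2; - y' 3; - y' 4; - y' 5; - y' 6])%R
  [:: - y k; - z 0; - z 1; - z 2; - z 3]%R.
have y0 : y 0 = r 10 by rewrite /y /r; ring.
have r0 : t 0 = r 0 by rewrite /r; ring.
have s0 : run 1 (s 0) 9
    = [:: r 9; r 8; r 7; r 6; r 5; r 4; r 3; r 2; r 1].
  by rewrite /run /s /r /=; congr [:: _; _; _; _; _; _; _; _; _]; ring.
have E : turn (run 1 (s k) (9 + 4 * k) ++ [:: t k; - y' 0; - y' 1;
  - y' 2; - y' 3; - y' 4; - y' 5; - y' 6])%R
  ++ [:: - y k; - z 0; - z 1; - z 2; - z 3]%R = run 1 1 n.
  rewrite (_ : n = 8 + ((9 + 4 * k) + 5)); last by rewrite /n; ring.
  rewrite turn_cat turn_run -catA (run_cat 1 1 8) (run_cat _ _ (9 + 4 * k) 5).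
  congr (_ ++ (run _ _ _ ++ _)).
  - by rewrite /turn /run /y' tk /=; congr [:: _; _; _; _; _; _; _; _]; ring.
  - by rewrite /s tk PoszD; ring.
  by rewrite /run /y /z tk /= !PoszD; congr [:: _; _; _; _; _]; ring.
rewrite neg_sorted_run sorted_run -E.
rewrite (_ : 35 + 6 * k =
  2 + (k + (17 + (2 * k + (5 + (2 * k + (10 + (k + 1)))))))); last by ring.
apply: reach_trans R0 _.
rewrite tk in R1.
apply: reach_trans R1 _.
apply: reach_trans R2 _.
apply: reach_trans R3 _.
apply: reach_trans R4 _.
rewrite y0 r0 in R5.
apply: reach_trans R5 _.
apply: reach_trans R6 _.
rewrite s0 in R7.
apply: reach_trans R7 _.
by rewrite catA.
Qed.

(** * The two bounds together *)

Lemma T_upper_bound n : 14 <= n -> ~~ odd n -> T n <= 3 * n %/ 2 + 2.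
Proof.
move=> n_ge14 n_even; have [n14 | n_neq14] := eqVneq n 14.
  rewrite n14; apply: T_leq; exists [:: 14; 7; 3; 13; 4; 7; 14; 10; 7; 12; 7; 9;
    13; 10; 3; 7; 12; 10; 2; 6; 11; 6; 9].
  by split; vm_compute.
have [n18 | n_neq18] := eqVneq n 18.
  rewrite n18; apply: T_leq; exists [:: 18; 11; 5; 8; 17; 3; 7; 18; 13; 6; 15;
    10; 2; 14; 9; 11; 16; 9; 5; 15; 13; 10; 17; 13; 7; 16; 11; 5; 14].
  by split; vm_compute.
have [n_mod4 | n_mod4] : n %% 4 = 0 \/ n %% 4 = 2 by lia.
  have nE : n = 16 + 4 * ((n - 16) %/ 4) by lia.
  rewrite nE; apply: leq_trans (T_leq (reach_0mod4 _)) _; lia.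
have nE : n = 22 + 4 * ((n - 22) %/ 4) by lia.
rewrite nE; apply: leq_trans (T_leq (reach_2mod4 _)) _; lia.
Qed.

Theorem corollary2 (n : nat) (n_ge14 : 14 <= n) (n_even : ~~ odd n) :
  T n \in [:: 3 * n %/ 2 + 1; 3 * n %/ 2 + 2].
Proof.
have lower : 3 * n < 2 * T n by apply: T_lower_bound; apply: leq_trans n_ge14.
have upper := T_upper_bound n_ge14 n_even.
rewrite !inE; lia.
Qed.
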